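(* Let $X$ be a Banach space, $A$ a sectorial operator on $X$ generating the analytic semigroup $(T_t)_{t\ge0}$, $B$ a closed linear operator with $\mathrm D(A)\subseteq\mathrm D(B)$ and $B\mathrm D(A)\subseteq \mathrm D(A)$. Assume the generalized nested commutators $\{B,A^m\}$ are defined for all $m\in\mathbb Z_+$, satisfy $\{B,A^m\}\mathrm{D}(A)\subseteq\mathrm{D}(A)$, and that there are $\eta>0$, $K_1>0$ with $\|\{B,A^{m}\}R_{A}(\lambda)\|\le K_1\eta^m/|\lambda-a|$ for all $m\in\mathbb Z_+$, $\lambda\in\Sigma_{a,\phi}$. Let $\{\tau_k\}_{k\ge0}$ be an increasing sequence with $\tau_k\to\infty$ satisfying the averaged dwell-time condition: there are $\theta>0$ and $\chi_{\max}\in[0,\theta)$ with $|\tau_k-\tau_0-k\theta|\le\chi_{\max}$ for all $k\in\mathbb Z_+$; set $\chi_k:=\tau_k-\tau_0-k\theta$. Assume further that $\{B,A^m\}T_{\theta-\chi_{\max}}\in L(X)$ for all $m\in\mathbb Z_+$ and $$2e\,\chi_{\max}\,\limsup_{m\to\infty}\frac{\|\{B,A^m\}T_{\theta-\chi_{\max}}\|^{1/m}}{m}<1.$$ Consider the impulsive system $$\dot x(t)=Ax(t),\ t\ne\tau_k,\quad x(\tau_0^+)=x_0\in\mathrm D(A),\qquad x(t^+)=Bx(t),\ t=\tau_k\ (k\ge1),\tag{S}$$ and the comparison system $$\dot z(t)=Az(t),\ t\ne k\theta,\quad z(0^+)=z_0\in\mathrm D(A),\qquad z(t^+)=Bz(t)+\sum_{m=1}^{\infty}\frac{(\chi_{\max}+\chi_{k+1})^m}{m!}\{B,A^m\}z(t),\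 t=k\theta\ (k\ge1).\tag{C}$$ Then asymptotic stability of (C) implies asymptotic stability of (S).
   Context: $R_A(\lambda)=(\lambda\,\mathrm{id}-A)^{-1}$; $A$ closed, densely defined, is sectorial if for some $a\in\mathbb R$, $\phi\in(\pi/2,\pi)$, $\Sigma_{a,\phi}:=\{\lambda\in\mathbb C\setminus\{a\}:|\arg(\lambda-a)|<\phi\}\subset\rho(A)$ and $\|R_A(\lambda)\|\le K/|\lambda-a|$ on $\Sigma_{a,\phi}$ for some $K>0$. Generalized nested commutators: $\{B,A^0\}:=B$; given $\{B,A^m\}$ with domain containing $\mathrm D(A)$, on $\widehat{\mathrm D}:=\{x\in \mathrm{D}(A)\cap\mathrm{D}(\{B,A^m\}) : Ax\in\mathrm{D}(\{B,A^m\}),\ \{B,A^m\}x\in\mathrm{D}(A)\}$ (required to contain $\mathrm D(A)$) the operator $x\mapsto \{B,A^m\}Ax-A\{B,A^m\}x$ is required to be closable, and $\{B,A^{m+1}\}$ is its closure. Solutions are understood piecewise via the semigroup: for (S), $x(t)=T_{t-\tau_k}x(\tau_k^+)$ for $t\in(\tau_k,\tau_{k+1}]$ and $x(\tau_{k}^+)=Bx(\tau_{k})$ for $k\ge1$; analogously for (C) with jump times $k\theta$. A system of this kind is asymptotically stable if (stability) for every $\varepsilon>0$ there is $\delta>0$ such that every solution with initial value of norm $<\delta$ satisfies $\|x(t)\|<\varepsilon$ for all $t$, and (attractivity) every solution tends to $0$ as $t\to\infty$. *)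

(* Defs.v *)
From mathcomp Require Import all_boot all_order all_algebra.
From mathcomp Require Import all_classical all_reals all_analysis.
From mathcomp Require Import complex.
Import Order.TTheory GRing.Theory Num.Theory.
Import numFieldNormedType.Exports.

Set Implicit Arguments.
Unset Strict Implicit.
Unset Printing Implicit Defensive.

Local Open Scope classical_set_scope.
Local Open Scope ring_scope.
Local Open Scope complex_scope.

Section Defs.
Variable R : realType.
Variable X : completeNormedModType R[i].

(* A (possibly unbounded) operator: its domain and its action
   (values outside the domain are irrelevant). *)
Definition op := (set X * (X -> X))%type.
Definition dom (A : op) : set X := A.1.
Definition app (A : op) : X -> X := A.2.

Definition graph (A : op) : set (X * X) :=
  [set p | dom A p.1 /\ p.2 = app A p.1].

Definition linear_op (A : op) :=
  dom A 0 /\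
  (forall x y, dom A x -> dom A y -> dom A (x + y) /\ app A (x + y) = app A x + app A y) /\
  (forall (c : R[i]) x, dom A x -> dom A (c *: x) /\ app A (c *: x) = c *: app A x).

Definition closed_op (A : op) := linear_op A /\ closed (graph A).

Definition densely_defined (A : op) := closure (dom A) = setT.

Definition bounded_lin (f : X -> X) :=
  (forall x y, f (x + y) = f x + f y) /\
  (forall (c : R[i]) x, f (c *: x) = c *: f x) /\
  exists M : R, forall x, `|f x| <= M%:C * `|x|.

Definition opnorm (f : X -> X) : R :=
  inf [set M : R | 0 <= M /\ forall x, `|f x| <= M%:C * `|x|].

Definition is_resolvent (A : op) (l : R[i]) (Rs : X -> X) :=
  bounded_lin Rs /\
  (forall y, dom A (Rs y) /\ l *: Rs y - app A (Rs y) = y) /\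
  (forall x, dom A x -> Rs (l *: x - app A x) = x).

Definition sector (a phi : R) : set R[i] :=
  [set l | l != a%:C /\ exists r psi : R, 0 < r /\ `|psi| < phi /\
             l - a%:C = (r * cos psi) +i* (r * sin psi)].

Definition sectorial (A : op) (a phi K : R) :=
  closed_op A /\ densely_defined A /\ pi / 2 < phi < pi /\ 0 < K /\
  forall l, sector a phi l ->
    exists Rs, is_resolvent A l Rs /\
      forall y, `|Rs y| <= (K%:C / `|l - a%:C|) * `|y|.

Definition generates (A : op) (T : R -> X -> X) :=
  (forall t, 0 <= t -> bounded_lin (T t)) /\
  (forall x, T 0 x = x) /\
  (forall s t x, 0 <= s -> 0 <= t -> T (s + t) x = T s (T t x)) /\
  (forall x, T t x @[t --> 0^'+] --> x) /\
  (forall x, dom A x <->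
     cvg (((t%:C)^-1 *: (T t x - x)) @[t --> 0^'+])) /\
  (forall x, dom A x ->
     ((t%:C)^-1 *: (T t x - x)) @[t --> 0^'+] --> app A x).

Definition hatD (A C : op) : set X :=
  [set x | dom A x /\ dom C x /\ dom C (app A x) /\ dom A (app C x)].

Definition nested_commutators (A B : op) (Cm : nat -> op) :=
  Cm 0%N = B /\
  forall m : nat,
    dom A `<=` dom (Cm m) /\
    dom A `<=` hatD A (Cm m) /\
    (* the closure of x |-> Cm m (A x) - A (Cm m x) on hatD exists
       (closability) and equals Cm (m+1) *)
    closure [set p : X * X | hatD A (Cm m) p.1 /\
               p.2 = app (Cm m) (app A p.1) - app A (app (Cm m) p.1)]
      = graph (Cm m.+1).

(* Impulsive system x' = A x between jump times s k; at time s (k+1),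
   x(s(k+1)^+) = J k (x(s(k+1))).  post k = x(s k ^+). *)
Fixpoint post_state (T : R -> X -> X) (s : nat -> R) (J : nat -> X -> X)
  (x0 : X) (k : nat) : X :=
  match k with
  | 0%N => x0
  | k'.+1 => J k' (T (s k'.+1 - s k') (post_state T s J x0 k'))
  end.

Definition is_solution (T : R -> X -> X) (s : nat -> R) (J : nat -> X -> X)
  (x0 : X) (x : R -> X) :=
  forall (k : nat) (t : R), s k < t <= s k.+1 ->
    x t = T (t - s k) (post_state T s J x0 k).

Definition asymp_stable (D : set X) (T : R -> X -> X) (s : nat -> R)
  (J : nat -> X -> X) :=
  (forall eps : R, 0 < eps -> exists2 delta : R, 0 < delta &
     forall x0 x, D x0 -> `|x0| < delta%:C -> is_solution T s J x0 x ->
       forall t, s 0%N < t -> `|x t| < eps%:C) /\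
  (forall x0 x, D x0 -> is_solution T s J x0 x ->
     x t @[t --> +oo] --> 0).

End Defs.

(* Main.v *)
(** Put E_m := {B,A^m} T_(theta-chimax).  For y in D(A) the functions
    phi_m(r) := T_(s-r) E_m T_r y satisfy phi_m' = phi_(m+1), because
    {B,A^(m+1)} = {B,A^m} A - A {B,A^m} on D(A).  Taylor's formula at r = s, whose
    remainder vanishes by the root test hypothesis, gives
      E_0 T_s y = T_s P_s y,   P_s y := \sum_m s^m/m! E_m y   (0 <= s <= 2 chimax),
    and P_s maps D(A) to itself since A is closed.  With s_k := chimax + chi_k and
    tau_(k+1) - tau_k = theta + s_(k+1) - s_k, the post-jump states x_k of (S) and z_k of
    (C) are then related by x_(k+1) = T_(s_(k+1)) z_k, if (C) is started at
    z_0 := P_(s_1) x_0.  So (S) inherits stability and attractivity from (C); the local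
    boundedness of T that this needs is itself read off from the stability of (C). *)

Require Import Defs.
From mathcomp Require Import all_boot all_order all_algebra.
From mathcomp Require Import all_classical all_reals all_analysis.
From mathcomp Require Import complex.
From mathcomp Require Import ring lra.
Import Order.TTheory GRing.Theory Num.Theory.
Import numFieldNormedType.Exports.
Local Open Scope classical_set_scope.
Local Open Scope ring_scope.
Local Open Scope complex_scope.

(** * Real-valued norm on a complex normed space *)

Section RealNorm.
Context {R : realType} {X : normedModType R[i]}.
Implicit Types (x y : X) (c e : R).

(** The norm of [X] takes values in [R[i]]. Its real part carries the same information and lives in
    an ordered field, where suprema, [lra] and [nra] are available. *)
Definition nrm (x : X) : R := complex.Re `|x|.

Lemma nrmE x : (nrm x)%:C = `|x|.
Proof. by rewrite /nrm RRe_real. Qed.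

Lemma nrm_ge0 x : 0 <= nrm x.
Proof. by rewrite -ler0c nrmE. Qed.

Lemma nrm0 : nrm (0 : X) = 0.
Proof. by rewrite /nrm normr0. Qed.

Lemma nrm_eq0 x : nrm x = 0 -> x = 0.
Proof. by move=> x0; apply/eqP; rewrite -normr_eq0 -nrmE x0. Qed.

Lemma nrmD x y : nrm (x + y) <= nrm x + nrm y.
Proof. by rewrite -lecR rmorphD /= !nrmE ler_normD. Qed.

Lemma nrmN x : nrm (- x) = nrm x.
Proof. by rewrite /nrm normrN. Qed.

Lemma nrmB x y : nrm (x - y) <= nrm x + nrm y.
Proof. by rewrite -(nrmN y) nrmD. Qed.

Lemma nrmBC x y : nrm (x - y) = nrm (y - x).
Proof. by rewrite -nrmN opprB. Qed.

Lemma nrmZ c x : nrm (c%:C *: x) = `|c| * nrm x.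
Proof.
apply: complexI; rewrite rmorphM /= !nrmE normrZ; congr (_ * _).
by rewrite normc_def /= expr0n /= addr0 sqrtr_sqr.
Qed.

Lemma nrm_sum (n : nat) (u : nat -> X) :
  nrm (\sum_(0 <= i < n) u i) <= \sum_(0 <= i < n) nrm (u i).
Proof.
elim: n => [|n IH]; first by rewrite !big_geq// nrm0.
by rewrite !big_nat_recr//= (le_trans (nrmD _ _))// lerD2r.
Qed.

Lemma cvg_nrmP {I} {F : set_system I} {FF : Filter F} (f : I -> X) (l : X) :
  f @ F --> l <-> forall e, 0 < e -> \forall i \near F, nrm (l - f i) < e.
Proof.
split=> [/cvgrPdist_lt fl e e0|H].
  have := fl e%:C; rewrite ltcR => /(_ e0); apply: filterS => i.
  by rewrite -nrmE ltcR.
(* A positive element of [R[i]] is real, so real tolerances suffice. *)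
apply/cvgrPdist_lt => e e0; have eE : e = (complex.Re e)%:C.
  by rewrite RRe_real// gtr0_real.
have := H (complex.Re e); rewrite -ltcR -eE => /(_ e0); apply: filterS => i.
by rewrite -nrmE [in X in _ -> X]eE ltcR.
Qed.

End RealNorm.

(** * Right derivatives, a mean value inequality and Taylor's formula *)

Section RightDerivative.
Context {R : realType}.

(* The condition on the left increments is only needed to reach the supremum of the set
   of times up to which f stays below the line of slope e. *)
Lemma le_upper_right_dini (f : R -> R) (s : R) : 0 <= s ->
  (forall t, 0 <= t < s -> forall e, 0 < e ->
     \forall h \near 0^'+, f (t + h) <= f t + e * h) ->
  (forall t, 0 < t <= s -> forall e, 0 < e ->
     \forall h \near 0^'+, f t <= f (t - h) + e) ->
  f s <= f 0.
Proof.
move=> s0 fr fl.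
suff H e : 0 < e -> f s <= f 0 + e * s.
  apply/ler_addgt0Pr => e e0; have s1 : 0 < s + 1 by rewrite ltr_wpDl.
  have := H (e / (s + 1)) (divr_gt0 e0 s1) => /le_trans; apply.
  by rewrite lerD2l mulrAC ler_pdivrMr// ler_pM2l// lerDl.
move=> e0.
pose S := [set t | 0 <= t <= s /\ forall u, 0 <= u <= t -> f u <= f 0 + e * u].
have S0 : S 0.
  by split=> [|u /le_anti <-]; rewrite ?lexx ?s0// mulr0 addr0.
have hS : has_sup S by split; [exists 0 | exists s => t [/andP[]]].
have ubS : ubound S (sup S) by apply: ub_le_sup; case: hS.
set c := sup S in ubS.
have c0 : 0 <= c by exact: ubS.
have cs : c <= s by apply: ge_sup; [exists 0 | move=> t [/andP[]]].
have below u : 0 <= u < c -> f u <= f 0 + e * u.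
  move=> /andP[u0 uc]; have [t St ut] := sup_gt (ex_intro _ 0 S0) uc.
  by case: St => _; apply; rewrite u0 ltW.
have fc : f c <= f 0 + e * c.
  move: c0; rewrite le_eqVlt => /predU1P[<-|c0]; first by rewrite mulr0 addr0.
  apply/ler_addgt0Pr => d d0.
  have : \forall h \near (0 : R)^'+, f c <= f 0 + e * c + d.
    near=> h.
    have h0 : 0 < h by near: h; exact: nbhs_right_gt.
    have hc : h < c by near: h; exact: nbhs_right_lt.
    have H1 : f c <= f (c - h) + d by near: h; apply: fl => //; rewrite c0.
    have H2 : f (c - h) <= f 0 + e * (c - h) by apply: below; lra.
    nra.
  by move=> /filter_ex[].
have Sc : S c.
  split=> [|u /andP[u0]]; first by rewrite c0.
  by rewrite le_eqVlt => /predU1P[->//|uc]; apply: below; rewrite u0.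
move: (cs); rewrite le_eqVlt => /predU1P[<-//|cs'].
have [d /= d0 Hd] : \forall h \near 0^'+, f (c + h) <= f c + e * h.
  by apply: fr => //; rewrite c0.
(* A step short enough for the slope estimate at [c] and for staying in [0, s]; it puts [c + r] into
   [S], beyond the supremum. *)
pose r := Num.min (d / 2) (s - c).
have r0 : 0 < r by rewrite lt_min; apply/andP; split; lra.
have rd : r < d by rewrite gt_min; apply/orP; left; lra.
have rs : r <= s - c by rewrite ge_min lexx orbT.
suff : c + r <= c by lra.
apply: ubS; split=> [|u /andP[u0 ur]]; first lra.
have [uc|uc] := leP u c; first by case: Sc => _; apply; rewrite u0.
have -> : u = c + (u - c) by lra.
have : f (c + (u - c)) <= f c + e * (u - c).
  by apply: Hd => /=; rewrite ?sub0r ?normrN ?ger0_norm; lra.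
nra.
Unshelve. all: by end_near. Qed.

Context {X : normedModType R[i]}.
Implicit Types (s t : R) (g : R -> X).

(* Right derivatives suffice: T_(s-r) = T_(s-r-h) T_h then puts the whole increment of
   phi_m over [r, r+h] under the single operator T_(s-r-h), and no continuity of the
   orbits other than at 0 is needed. *)
Definition rderiv s g g' := forall t, 0 <= t < s -> forall e : R, 0 < e ->
  \forall h \near 0^'+, nrm (g (t + h) - g t - h%:C *: g' t) <= e * h.

Definition lcont s g := forall t, 0 < t <= s -> forall e : R, 0 < e ->
  \forall h \near 0^'+, nrm (g t - g (t - h)) <= e.

Lemma rderivB s f f' g g' : rderiv s f f' -> rderiv s g g' ->
  rderiv s (fun t => f t - g t) (fun t => f' t - g' t).
Proof.
move=> ff gg t ts e e0; have e2 : 0 < e / 2 by lra.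
near=> h.
have H1 : nrm (f (t + h) - f t - h%:C *: f' t) <= e / 2 * h.
  by near: h; exact: ff.
have H2 : nrm (g (t + h) - g t - h%:C *: g' t) <= e / 2 * h.
  by near: h; exact: gg.
have := le_trans (nrmB _ _) (lerD H1 H2); rewrite -mulrDl -splitr.
rewrite [Y in nrm Y](_ : _ = f (t + h) - g (t + h) - (f t - g t) -
  h%:C *: (f' t - g' t))//.
by rewrite scalerBr !opprD addrACA (addrACA (f _)).
Unshelve. all: by end_near. Qed.

Lemma rderiv_sum s (n : nat) (f f' : nat -> R -> X) :
  (forall i, rderiv s (f i) (f' i)) ->
  rderiv s (fun t => \sum_(0 <= i < n) f i t) (fun t => \sum_(0 <= i < n) f' i t).
Proof.
move=> ff; elim: n => [t _ e e0|n IH].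
  near=> h; have h0 : 0 <= h by near: h; exact: nbhs_right_ge.
  by rewrite !big_geq// scaler0 !subr0 nrm0 mulr_ge0// ltW.
(* With S the partial sum, S + f_n is written as S - ((S - S) - f_n), so that the rule for
   differences is enough. *)
have H := rderivB _ _ _ _ _ IH (rderivB _ _ _ _ _ (rderivB _ _ _ _ _ IH IH) (ff n)).
move=> t ts e e0; have := H t ts e e0; apply: filterS => h.
by rewrite !big_nat_recr//= !subrr !sub0r !opprK.
Unshelve. all: by end_near. Qed.

Lemma lcontB s f g : lcont s f -> lcont s g -> lcont s (fun t => f t - g t).
Proof.
move=> ff gg t ts e e0; have e2 : 0 < e / 2 by lra.
near=> h.
have H1 : nrm (f t - f (t - h)) <= e / 2 by near: h; exact: ff.
have H2 : nrm (g t - g (t - h)) <= e / 2 by near: h; exact: gg.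
have := le_trans (nrmB _ _) (lerD H1 H2); rewrite -splitr.
by rewrite !opprD addrACA.
Unshelve. all: by end_near. Qed.

Lemma lcont_sum s (n : nat) (f : nat -> R -> X) : (forall i, lcont s (f i)) ->
  lcont s (fun t => \sum_(0 <= i < n) f i t).
Proof.
move=> ff; elim: n => [t _ e e0|n IH].
  by near=> h; rewrite !big_geq// subr0 nrm0 ltW.
have H := lcontB _ _ _ IH (lcontB _ _ _ (lcontB _ _ _ IH IH) (ff n)).
move=> t ts e e0; have := H t ts e e0; apply: filterS => h.
by rewrite !big_nat_recr//= !subrr !sub0r !opprK.
Unshelve. all: by end_near. Qed.

(* Divided power. *)
Definition dpow (t : R) (n : nat) : R := t ^+ n / n`!%:R.

Lemma dpow0n n : dpow 0 n.+1 = 0.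
Proof. by rewrite /dpow expr0n mul0r. Qed.

Lemma dpowt0 t : dpow t 0 = 1.
Proof. by rewrite /dpow expr0 fact0 divr1. Qed.

Lemma dpow_ge0 t n : 0 <= t -> 0 <= dpow t n.
Proof. by move=> t0; rewrite divr_ge0// exprn_ge0. Qed.

Lemma dpow_le t u n : 0 <= t <= u -> dpow t n <= dpow u n.
Proof.
move=> /andP[t0 tu]; rewrite ler_wpM2r ?invr_ge0// lerXn2r// nnegrE//.
exact: le_trans tu.
Qed.

(** Bernoulli's inequality in homogeneous form: multiplying the induction hypothesis by t + h leaves
    the nonnegative excess (n+1) h^2 t^n. It serves both the mean value inequality and the root
    test. *)
Lemma exprD_ge t h n : 0 <= t -> 0 <= h ->
  t ^+ n.+1 + n.+1%:R * h * t ^+ n <= (t + h) ^+ n.+1.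
Proof.
move=> t0 h0; elim: n => [|n IH]; first by rewrite !expr1 expr0 mul1r mulr1.
rewrite [leRHS]exprS; apply: le_trans (ler_wpM2l (addr_ge0 t0 h0) IH).
rewrite -subr_ge0 [leRHS](_ : _ = n.+1%:R * h ^+ 2 * t ^+ n).
  by rewrite !mulr_ge0// exprn_ge0.
by rewrite !exprS -(natr1 n.+1); ring.
Qed.

Lemma fact_neq0 n : n`!%:R != 0 :> R.
Proof. by rewrite pnatr_eq0 -lt0n fact_gt0. Qed.

Lemma dpowD_ge t h n : 0 <= t -> 0 <= h ->
  dpow t n.+1 + h * dpow t n <= dpow (t + h) n.+1.
Proof.
move=> t0 h0; rewrite /dpow ler_pdivlMr ?ltr0n ?fact_gt0//.
rewrite (le_trans _ (exprD_ge _ _ n t0 h0))// le_eqVlt; apply/orP; left; apply/eqP.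
have F := fact_neq0 n; have F2 : n.+1%:R != 0 :> R by rewrite pnatr_eq0.
by rewrite factS natrM; field; exact/andP.
Qed.

(** Both signs of [h] are allowed: positive ones give right derivatives, negative ones left
    continuity. *)
Lemma exprD_approx t n : exists2 K, 0 <= K & forall h, `|h| <= 1 ->
  `|(t + h) ^+ n.+1 - t ^+ n.+1 - n.+1%:R * h * t ^+ n| <= K * h ^+ 2.
Proof.
elim: n => [|n [K K0 IH]].
  exists 0 => // h _; rewrite !expr1 expr0 !mul1r mulr1 mul0r.
  by rewrite (_ : t + h - t - h = 0) ?normr0//; ring.
(* The next remainder is t + h times the previous one plus (n+1) t^n h^2, and |t + h| is at most |t|
   + 1. *)
exists ((`|t| + 1) * K + n.+1%:R * `|t| ^+ n) => [|h h1].
  by rewrite addr_ge0// mulr_ge0// ?exprn_ge0// addr_ge0.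
rewrite (_ : _ - _ = (t + h) * ((t + h) ^+ n.+1 - t ^+ n.+1 - n.+1%:R * h * t ^+ n)
   + n.+1%:R * t ^+ n * h ^+ 2); last first.
  by rewrite !exprS -(natr1 n.+1); ring.
rewrite (le_trans (ler_normD _ _))// [leRHS]mulrDl lerD//.
  rewrite normrM -[leRHS]mulrA ler_pM// ?IH//.
  by rewrite (le_trans (ler_normD t h)) ?lerD2l.
by rewrite !normrM normr_nat !normrX -(normrM h h) -expr2 (ger0_norm (sqr_ge0 h)).
Qed.

Lemma dpowD_approx t n : exists2 K, 0 <= K & forall h, `|h| <= 1 ->
  `|dpow (t + h) n.+1 - dpow t n.+1 - h * dpow t n| <= K * h ^+ 2.
Proof.
have [K K0 H] := exprD_approx t n.
have F : 0 < n.+1`!%:R :> R by rewrite ltr0n fact_gt0.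
exists (K / n.+1`!%:R) => [|h h1]; first by rewrite divr_ge0.
rewrite mulrAC ler_pdivlMr// -[X in _ * X](gtr0_norm F) -normrM.
rewrite [Y in `|Y|](_ : _ = (t + h) ^+ n.+1 - t ^+ n.+1 - n.+1%:R * h * t ^+ n) ?H//.
have F' := fact_neq0 n.
have F2 : n.+1%:R != 0 :> R by rewrite pnatr_eq0.
rewrite /dpow factS natrM; field; exact/andP.
Qed.

Lemma rderiv_dpow s n (v : X) :
  rderiv s (fun t => (dpow t n.+1)%:C *: v) (fun t => (dpow t n)%:C *: v).
Proof.
move=> t ts e e0; have [K K0 H] := dpowD_approx t n.
have Kv : 0 < K * nrm v + 1 by rewrite ltr_wpDl// mulr_ge0// nrm_ge0.
near=> h.
have h0 : 0 < h by near: h; exact: nbhs_right_gt.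
have h1 : h <= 1 by near: h; exact: nbhs_right_le.
have he : h <= e / (K * nrm v + 1).
  by near: h; apply: nbhs_right_le; rewrite divr_gt0.
rewrite ler_pdivlMr// in he.
rewrite scalerA -rmorphM -!scalerBl -!rmorphB nrmZ.
have := H h; rewrite gtr0_norm// => /(_ h1) /(ler_wpM2r (nrm_ge0 v)).
have := nrm_ge0 v; set N := nrm v in he *; nra.
Unshelve. all: by end_near. Qed.

Lemma lcont_dpow s n (v : X) : lcont s (fun t => (dpow t n.+1)%:C *: v).
Proof.
move=> t /andP[t0 ts] e e0; have [K K0 H] := dpowD_approx t n.
set L := (K + dpow t n) * nrm v + 1.
have c0 := dpow_ge0 t n (ltW t0).
have Kv : 0 < L by rewrite ltr_wpDl// mulr_ge0// ?nrm_ge0// addr_ge0.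
near=> h.
have h0 : 0 < h by near: h; exact: nbhs_right_gt.
have h1 : h <= 1 by near: h; exact: nbhs_right_le.
have he : h <= e / L by near: h; apply: nbhs_right_le; rewrite divr_gt0.
rewrite ler_pdivlMr// in he; apply: le_trans he.
rewrite -scalerBl -rmorphB nrmZ.
have := H (- h); rewrite normrN gtr0_norm// => /(_ h1); rewrite sqrrN => Hh.
have {Hh} : `|dpow t n.+1 - dpow (t - h) n.+1| <= K * h ^+ 2 + h * dpow t n.
  rewrite -(subrK (h * dpow t n) (_ - _)) (le_trans (ler_normD _ _))// lerD//.
    apply: le_trans Hh; rewrite -normrN le_eqVlt; apply/orP; left; apply/eqP.
    by congr (`|_|); ring.
  by rewrite ger0_norm// mulr_ge0// ltW.
move=> /(ler_wpM2r (nrm_ge0 v)) /le_trans; apply.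
have := nrm_ge0 v; rewrite /L; set N := nrm v; set c := dpow t n in c0 * => N0.
have : K * N * (h * h) <= K * N * h.
  by rewrite ler_wpM2l ?mulr_ge0// ger_pMl.
nra.
Unshelve. all: by end_near. Qed.

(** Apply [le_upper_right_dini] to the norm of [g t - g 0] minus the claimed bound: to the right the
    norm grows at rate at most [nrm (g' t)], and by [dpowD_ge] the bound grows at least that
    fast. *)
Lemma nrm_mean_value s n C g g' : 0 <= C -> rderiv s g g' -> lcont s g ->
  (forall t, 0 <= t <= s -> nrm (g' t) <= C * dpow t n) ->
  forall t, 0 <= t <= s -> nrm (g t - g 0) <= C * dpow t n.+1.
Proof.
move=> C0 gg' gc bg t /andP[t0 ts].
suff: nrm (g t - g 0) - C * dpow t n.+1 <= nrm (g 0 - g 0) - C * dpow 0 n.+1.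
  by rewrite subrr nrm0 dpow0n mulr0 subr0 subr_le0.
pose f u := nrm (g u - g 0) - C * dpow u n.+1.
apply: (@le_upper_right_dini f) => // u.
  move=> /andP[u0 ut] e e0; near=> h.
  have h0 : 0 < h by near: h; exact: nbhs_right_gt.
  have us : 0 <= u < s by rewrite u0 (lt_le_trans ut).
  have : nrm (g (u + h) - g u - h%:C *: g' u) <= e * h.
    by near: h; apply: gg' => //; lra.
  have := bg u; rewrite u0 (ltW (lt_le_trans ut ts)) => /(_ isT).
  have : nrm (g (u + h) - g 0) <= nrm (g (u + h) - g u - h%:C *: g' u) +
     h * nrm (g' u) + nrm (g u - g 0).
    have -> : h * nrm (g' u) = nrm (h%:C *: g' u) by rewrite nrmZ gtr0_norm.
    rewrite (_ : g (u + h) - g 0 =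
      g (u + h) - g u - h%:C *: g' u + h%:C *: g' u + (g u - g 0)).
      by rewrite (le_trans (nrmD _ _))// lerD2r nrmD.
    by rewrite subrK addrA subrK.
  have : C * dpow (u + h) n.+1 >= C * dpow u n.+1 + h * (C * dpow u n).
    by rewrite (mulrCA h) -mulrDr ler_wpM2l// dpowD_ge// ltW.
  rewrite /f; nra.
move=> /andP[u0 ut] e e0; near=> h.
have h0 : 0 < h by near: h; exact: nbhs_right_gt.
have hu : h <= u by near: h; exact: nbhs_right_le.
have : nrm (g u - g (u - h)) <= e.
  by near: h; apply: gc => //; rewrite u0 (le_trans ut).
have : nrm (g u - g 0) <= nrm (g u - g (u - h)) + nrm (g (u - h) - g 0).
  by rewrite -{1}(subrK (g (u - h)) (g u)) -addrA nrmD.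
have : C * dpow (u - h) n.+1 <= C * dpow u n.+1.
  by rewrite ler_wpM2l// dpow_le//; lra.
rewrite /f; lra.
Unshelve. all: by end_near. Qed.

Lemma nrm_taylor s n C (phi : nat -> R -> X) : 0 <= C ->
  (forall m, rderiv s (phi m) (phi m.+1)) -> (forall m, lcont s (phi m)) ->
  (forall t, 0 <= t <= s -> nrm (phi n t) <= C) ->
  forall t, 0 <= t <= s ->
    nrm (phi 0%N t - \sum_(0 <= i < n) (dpow t i)%:C *: phi i 0) <= C * dpow t n.
Proof.
move=> C0; elim: n phi => [|n IH] phi dphi cphi bphi t ts.
  by rewrite big_geq// subr0 dpowt0 mulr1 bphi.
(* Only the constant Taylor term is left in [g]. Its right derivative is the remainder of the
   shifted family [phi m.+1], which the induction hypothesis bounds; the mean value inequality then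
   gains one order. *)
pose g u := phi 0%N u - \sum_(0 <= i < n) (dpow u i.+1)%:C *: phi i.+1 0.
have g0 : g 0 = phi 0%N 0.
  by rewrite /g big1 ?subr0// => i _; rewrite dpow0n scale0r.
rewrite big_nat_recl// dpowt0 scale1r opprD addrA addrAC -g0.
apply: nrm_mean_value C0 _ _ _ _ ts; last first.
- exact: (IH (fun m => phi m.+1)).
- by apply: lcontB => //; apply: lcont_sum => i; exact: lcont_dpow.
- by apply: rderivB => //; apply: rderiv_sum => i; exact: rderiv_dpow.
Qed.

End RightDerivative.

(** * Bounded linear maps and the operator norm *)

Section BoundedLinear.
Context {R : realType} {X : completeNormedModType R[i]}.
Implicit Types (f : X -> X) (x y : X).

Lemma bounded_linD f x y : bounded_lin f -> f (x + y) = f x + f y.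
Proof. by case. Qed.

Lemma bounded_linZ f (c : R[i]) x : bounded_lin f -> f (c *: x) = c *: f x.
Proof. by case=> _ []. Qed.

Lemma bounded_lin0 f : bounded_lin f -> f 0 = 0.
Proof. by move=> bf; rewrite -[Y in f Y](scale0r (0 : X)) bounded_linZ// scale0r. Qed.

Lemma bounded_linN f x : bounded_lin f -> f (- x) = - f x.
Proof. by move=> bf; rewrite -scaleN1r bounded_linZ// scaleN1r. Qed.

Lemma bounded_linB f x y : bounded_lin f -> f (x - y) = f x - f y.
Proof. by move=> bf; rewrite bounded_linD// bounded_linN. Qed.

Lemma bounded_lin_sum f (n : nat) (c : nat -> R[i]) (u : nat -> X) :
  bounded_lin f ->
  f (\sum_(0 <= i < n) c i *: u i) = \sum_(0 <= i < n) c i *: f (u i).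
Proof.
move=> bf; elim: n => [|n IH]; first by rewrite !big_geq// bounded_lin0.
by rewrite !big_nat_recr//= bounded_linD// bounded_linZ// IH.
Qed.

Lemma bounded_lin_bound f : bounded_lin f ->
  exists2 M : R, 0 <= M & forall x, nrm (f x) <= M * nrm x.
Proof.
move=> [_ [_ [M fM]]]; exists `|M| => // x.
have := fM x; rewrite -!nrmE -rmorphM lecR => /le_trans; apply.
by rewrite ler_wpM2r ?nrm_ge0// ler_norm.
Qed.

(** The infimum defining [opnorm] is itself an admissible constant: for each x of nonzero norm, the
    quotient of [nrm (f x)] by [nrm x] is a lower bound of all admissible ones. *)
Lemma opnorm_bound f : bounded_lin f ->
  0 <= opnorm f /\ forall x, nrm (f x) <= opnorm f * nrm x.
Proof.
move=> bf; have [M M0 fM] := bounded_lin_bound f bf.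
pose S := [set N : R | 0 <= N /\ forall x, `|f x| <= N%:C * `|x|].
have SM : S M by split=> // x; rewrite -!nrmE -rmorphM lecR.
have S0 : lbound S 0 by move=> N [].
have hS : has_inf S by split; [exists M|exists 0].
split=> [|x]; first by apply: lb_le_inf => //; exists M.
have [x0|x0] := eqVneq (nrm x) 0.
  by rewrite x0 mulr0 (nrm_eq0 _ x0) bounded_lin0// nrm0.
have {}x0 : 0 < nrm x by rewrite lt_def x0 nrm_ge0.
rewrite -ler_pdivrMr//; apply: lb_le_inf; first by exists M.
by move=> N [N0 /(_ x)]; rewrite -!nrmE -rmorphM lecR -ler_pdivrMr.
Qed.

Lemma bounded_lin_cvg f {I} {F : set_system I} {FF : Filter F} (u : I -> X) x :
  bounded_lin f -> u @ F --> x -> (fun i => f (u i)) @ F --> f x.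
Proof.
move=> bf /cvg_nrmP ux; have [M M0 fM] := bounded_lin_bound f bf.
have M1 : 0 < M + 1 by rewrite ltr_wpDl.
apply/cvg_nrmP => e e0; have := ux _ (divr_gt0 e0 M1).
apply: filterS => i; rewrite ltr_pdivlMr// => h.
rewrite -bounded_linB// (le_lt_trans (fM _))// (le_lt_trans _ h)// mulrC.
by rewrite ler_wpM2l ?nrm_ge0// lerDl.
Qed.

End BoundedLinear.

(** * The semigroup and its generator *)

Section Semigroup.
Context {R : realType} {X : completeNormedModType R[i]}.
Context {A : op X} {T : R -> X -> X}.
Hypothesis AT : generates A T.
Implicit Types (s t : R) (x y : X).

Lemma sg_lin t : 0 <= t -> bounded_lin (T t).
Proof. by case: AT => H _; exact: H. Qed.

Lemma sg0 x : T 0 x = x.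
Proof. by case: AT => _ [H _]. Qed.

Lemma sgD s t x : 0 <= s -> 0 <= t -> T (s + t) x = T s (T t x).
Proof. by case: AT => _ [_ [H _]]; exact: H. Qed.

Lemma sg_right_continuous x (e : R) : 0 < e ->
  \forall h \near 0^'+, nrm (T h x - x) <= e.
Proof.
case: AT => _ [_ [_ [/(_ x)/cvg_nrmP H _]]] /H.
by apply: filterS => h; rewrite nrmBC => /ltW.
Qed.

Lemma sg_right_derivative x (e : R) : dom A x -> 0 < e ->
  \forall h \near 0^'+, nrm (T h x - x - h%:C *: app A x) <= e * h.
Proof.
case: AT => _ [_ [_ [_ [_ H]]]] /H/cvg_nrmP {}H /H {}H; near=> h.
have h0 : 0 < h by near: h; exact: nbhs_right_gt.
have : nrm (app A x - h%:C^-1 *: (T h x - x)) <= e.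
  by apply: ltW; near: h; exact: H.
rewrite -(ler_pM2l h0) -{1}(gtr0_norm h0) -nrmZ (mulrC h).
rewrite scalerBr scalerA mulfV ?scale1r; last first.
  by rewrite -(rmorph0 (real_complex R)) (inj_eq (@complexI R)) gt_eqF.
by rewrite nrmBC.
Unshelve. all: by end_near. Qed.

(** T_t commutes with the difference quotients (T_h - 1)/h and is continuous, so the quotients at
    T_t x converge to T_t A x. *)
Lemma sg_dom t x : 0 <= t -> dom A x ->
  dom A (T t x) /\ app A (T t x) = T t (app A x).
Proof.
move=> t0 Ax; case: (AT) => _ [_ [_ [_ [domP derP]]]].
have : ((h%:C)^-1 *: (T h (T t x) - T t x)) @[h --> 0^'+] --> T t (app A x).
  apply: cvg_trans (bounded_lin_cvg (T t) _ _ (sg_lin t t0) (derP x Ax)).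
  apply: near_eq_cvg; near=> h.
  have h0 : 0 < h by near: h; exact: nbhs_right_gt.
  have hp := ltW h0.
  have bT := sg_lin t t0.
  by rewrite (bounded_linZ (T t))// (bounded_linB (T t))// -!sgD// (addrC h).
move=> H; have AT' : dom A (T t x) by apply/domP; exact: (cvgP _ H).
split=> //; have := derP _ AT' => H'.
exact: (cvg_unique _ H' H).
Unshelve. all: by end_near. Qed.

End Semigroup.

(** * Series dominated by a geometric one *)

Section GeometricSeries.
Context {R : realType} {X : completeNormedModType R[i]}.

Lemma cvg_nrm_le {I} {F : set_system I} {FF : ProperFilter F} (u : I -> X) l c :
  u @ F --> l -> (forall i, nrm (u i) <= c) -> nrm l <= c.
Proof.
move=> /cvg_nrmP ul uc; apply/ler_addgt0Pr => e /ul/filter_ex[i /ltW li].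
by rewrite -(subrK (u i) l) (le_trans (nrmD _ _))// addrC lerD.
Qed.

Lemma sum_geometric_le (C q : R) n : 0 <= C -> 0 <= q < 1 ->
  \sum_(0 <= i < n) C * q ^+ i <= C / (1 - q).
Proof.
move=> C0 /andP[q0 q1]; have q1' : 0 < 1 - q by rewrite subr_gt0.
rewrite ler_pdivlMr// -mulr_sumr -mulrA ler_piMr//.
suff -> : (\sum_(0 <= i < n) q ^+ i) * (1 - q) = 1 - q ^+ n.
  by rewrite gerBl exprn_ge0.
elim: n => [|n IH]; first by rewrite big_geq// mul0r expr0 subrr.
by rewrite big_nat_recr//= mulrDl IH exprS; ring.
Qed.

Lemma series_geometric_bound (u : nat -> X) (C q : R) : 0 <= C -> 0 <= q < 1 ->
  (forall m, nrm (u m) <= C * q ^+ m) ->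
  exists2 l, (fun n => \sum_(0 <= i < n) u i) @ \oo --> l & nrm l <= C / (1 - q).
Proof.
move=> C0 q01 uC; have /andP[q0 q1] := q01.
have cu : cvg ((fun n => \sum_(0 <= i < n) u i) @ \oo).
  apply/cauchy_cvgP/cauchy_seriesP => e e0.
  have eE : e = (complex.Re e)%:C by rewrite RRe_real// gtr0_real.
  have e0' : 0 < complex.Re e by rewrite -ltcR -eE.
  (* The blocks of the real geometric series dominate those of [u]; completeness of [X] does the
     rest. *)
  have /cauchy_cvgP/cauchy_seriesP /(_ _ e0') : cvgn (series (geometric C q)).
    by apply: is_cvg_geometric_series; rewrite ger0_norm.
  apply: filterS => -[n1 n2] /= h.
  rewrite eE -nrmE ltcR; apply: le_lt_trans h.
  apply: le_trans (ler_norm _).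
  elim: n2 => [|n2 IH]; first by rewrite !big_geq// nrm0.
  have [n12|n12] := leqP n1 n2; last by rewrite !big_geq// nrm0.
  by rewrite !big_nat_recr//= (le_trans (nrmD _ _))// lerD.
have /cvg_ex[l ul] := cu; exists l => //; apply: cvg_nrm_le ul _ => n.
apply: le_trans (nrm_sum _ _) _; apply: le_trans (sum_geometric_le C q n C0 q01).
by apply: ler_sum.
Qed.

End GeometricSeries.

(** * Moving the semigroup past E_0 by Taylor expansion *)

Section Exchange.
Context {R : realType} {X : completeNormedModType R[i]}.
Context {A : op X} {T : R -> X -> X} {E : nat -> X -> X} {M s : R}.
Hypothesis AT : generates A T.
Hypothesis E_lin : forall m, bounded_lin (E m).
Hypothesis E_dom : forall m y, dom A y -> dom A (E m y).
Hypothesis E_comm : forall m y, dom A y ->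
  E m.+1 y = E m (app A y) - app A (E m y).
Hypotheses (M0 : 0 <= M) (s0 : 0 <= s).
Hypothesis T_bound : forall t x, 0 <= t <= s -> nrm (T t x) <= M * nrm x.

Let phi y m t := T (s - t) (E m (T t y)).

(** Product rule: differentiating the inner T_t yields E_m A, differentiating the outer T_(s-t)
    yields -A E_m, and [E_comm] turns their sum into E_(m+1). *)
Lemma exchange_rderiv y m : dom A y -> rderiv s (phi y m) (phi y m.+1).
Proof.
move=> Ay t /andP[t0 ts] e e0.
have [L L0 EL] := bounded_lin_bound _ (E_lin m).
(* Three errors arise below, of sizes L d h, d h and d h, all under an operator bounded by [M]; the
   1 keeps the divisor positive. *)
set d := e / (M * (L + 2) + 1).
have c0 : 0 < M * (L + 2) + 1 by rewrite ltr_wpDl// mulr_ge0// addr_ge0.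
have d0 : 0 < d by rewrite divr_gt0.
have [Av ATv] := sg_dom AT t y t0 Ay.
set v := T t y in Av ATv; set p := E m v.
have Ap : dom A p by exact: E_dom.
set q := E m (app A v).
near=> h.
have h0 : 0 < h by near: h; exact: nbhs_right_gt.
have hs : h <= s - t by near: h; apply: nbhs_right_le; rewrite subr_gt0.
have H1 : nrm (T h v - v - h%:C *: app A v) <= d * h.
  by near: h; exact: sg_right_derivative.
have H2 : nrm (T h p - p - h%:C *: app A p) <= d * h.
  by near: h; exact: sg_right_derivative.
have H3 : nrm (T h (q - app A p) - (q - app A p)) <= d.
  by near: h; exact: (sg_right_continuous AT).
have hp := ltW h0; have sth : 0 <= s - t - h by rewrite subr_ge0.
have bT := sg_lin AT _ sth.
rewrite /phi (_ : s - t = s - t - h + h); last by rewrite subrK.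
rewrite (_ : s - (t + h) = s - t - h); last by ring.
rewrite (addrC t h) (sgD AT _ _ _ hp t0) !(sgD AT _ _ _ sth hp) -/v -/p E_comm// -/p -/q.
rewrite -bounded_linZ// -!bounded_linB//.
(* The first-order errors of the orbits of [v] (seen through [E m]) and of [p], and the displacement
   by T_h of [q - app A p], which is E_(m+1) v. *)
have -> : E m (T h v) - T h p - h%:C *: T h (q - app A p) =
  E m (T h v - v - h%:C *: app A v) - (T h p - p - h%:C *: app A p) -
  h%:C *: (T h (q - app A p) - (q - app A p)).
  rewrite !(bounded_linB (E m))// (bounded_linZ (E m))// -/p -/q !scalerBr.
  set x1 := E m _; set x2 := T h p; set x3 := h%:C *: q.
  set x4 := h%:C *: app A p; set x5 := h%:C *: T h _.
  have -> : x1 - p - x3 - (x2 - p - x4) = x1 - x2 - (x3 - x4).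
    rewrite (opprD (x2 - p)) addrACA (opprD x3); congr (_ + _).
    by rewrite opprB addrA subrK.
  by rewrite (opprB x5) addrA subrK.
have Tb : 0 <= s - t - h <= s by rewrite sth; lra.
apply: le_trans (T_bound _ _ Tb) _.
have -> : e = (M * (L + 2) + 1) * d by rewrite mulrC /d divfK// gt_eqF.
have H4 : nrm (h%:C *: (T h (q - app A p) - (q - app A p))) <= h * d.
  by rewrite nrmZ gtr0_norm// ler_pM2l.
have H5 := le_trans (EL _) (ler_wpM2l L0 H1).
have := le_trans (nrmB _ _) (lerD (le_trans (nrmB _ _) (lerD H5 H2)) H4).
move=> /(ler_wpM2l M0) /le_trans; apply.
have dh : 0 <= d * h by rewrite mulr_ge0 ?ltW.
nra.
Unshelve. all: by end_near. Qed.

(** Right continuity at 0 suffices on the left too: T_t y - T_(t-h) y = T_(t-h) (T_h y - y), and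
    [T_bound] controls T_(t-h) uniformly in h. *)
Lemma exchange_lcont y m : lcont s (phi y m).
Proof.
move=> t /andP[t0 ts] e e0.
have [L L0 EL] := bounded_lin_bound _ (E_lin m).
set p := E m (T t y).
set c := M * (1 + M * (L * M)) + 1.
have c0 : 0 < c by rewrite ltr_wpDl// !(mulr_ge0, addr_ge0).
have d0 : 0 < e / c by rewrite divr_gt0.
near=> h.
have h0 : 0 < h by near: h; exact: nbhs_right_gt.
have ht : h <= t by near: h; exact: nbhs_right_le.
have H1 : nrm (T h p - p) <= e / c by near: h; exact: (sg_right_continuous AT).
have H2 : nrm (T h y - y) <= e / c by near: h; exact: (sg_right_continuous AT).
have th : 0 <= t - h by rewrite subr_ge0.
have st : 0 <= s - t by rewrite subr_ge0.
have bT := sg_lin AT _ st; have hp := ltW h0.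
have bTh := sg_lin AT _ hp; have bTth := sg_lin AT _ th.
rewrite /phi (_ : s - (t - h) = s - t + h); last by ring.
rewrite (sgD AT _ _ _ st hp) -bounded_linB// -/p.
have Tb u : 0 <= u <= t -> 0 <= u <= s.
  by move=> /andP[-> ut]; exact: le_trans ut ts.
have Tbst : 0 <= s - t <= s by rewrite st; lra.
apply: le_trans (T_bound _ _ Tbst) _.
have -> : p - T h (E m (T (t - h) y)) =
    p - T h p + T h (E m (T (t - h) (T h y - y))).
  rewrite (bounded_linB (T _))// -(sgD AT)// subrK.
  by rewrite (bounded_linB (E m))// (bounded_linB (T h))// addrA subrK.
have H3 : nrm (T h (E m (T (t - h) (T h y - y)))) <= M * (L * (M * (e / c))).
  apply: le_trans (T_bound _ _ _) _; first by apply: Tb; rewrite hp.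
  rewrite ler_wpM2l//; apply: le_trans (EL _) _; rewrite ler_wpM2l//.
  apply: le_trans (T_bound _ _ _) _; first by apply: Tb; rewrite th; lra.
  by rewrite ler_wpM2l.
rewrite nrmBC in H1.
have := le_trans (nrmD _ _) (lerD H1 H3).
move=> /(ler_wpM2l M0) /le_trans; apply.
rewrite [leRHS](_ : e = c * (e / c)); last by rewrite mulrC divfK// gt_eqF.
have := ltW d0; set d := e / c; rewrite /c; nra.
Unshelve. all: by end_near. Qed.

Lemma semigroup_exchange y P : dom A y ->
  (fun n => dpow s n * opnorm (E n)) @ \oo --> (0 : R) ->
  (fun n => \sum_(0 <= i < n) (dpow s i)%:C *: E i y) @ \oo --> P ->
  E 0%N (T s y) = T s P.
Proof.
move=> Ay b0 SP; have bT := sg_lin AT _ s0.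
have H n : nrm (E 0%N (T s y) - T s (\sum_(0 <= i < n) (dpow s i)%:C *: E i y)) <=
    M * (M * nrm y) * (dpow s n * opnorm (E n)).
  have [L0 EL] := opnorm_bound _ (E_lin n).
  have C0 : 0 <= M * (opnorm (E n) * (M * nrm y)).
    by rewrite !mulr_ge0// nrm_ge0.
  have B t : 0 <= t <= s -> nrm (phi y n t) <= M * (opnorm (E n) * (M * nrm y)).
    move=> /andP[t0 ts]; apply: le_trans (T_bound _ _ _) _; first lra.
    rewrite ler_wpM2l//; apply: le_trans (EL _) _; rewrite ler_wpM2l//.
    by apply: T_bound; rewrite t0.
  (* Taylor's formula at t = s: there the outer semigroup factor is T_0, while the coefficients at 0
     are T_s E_i y. *)
  have := nrm_taylor s n _ (phi y) C0 (fun m => exchange_rderiv y m Ay)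
     (exchange_lcont y) B s; rewrite s0 lexx => /(_ isT).
  rewrite /phi subrr !(sg0 AT) subr0.
  rewrite -bounded_lin_sum// => /le_trans; apply.
  by rewrite le_eqVlt; apply/orP; left; apply/eqP; ring.
apply/eqP; rewrite -subr_eq0; apply/eqP; apply: nrm_eq0; apply/le_anti.
rewrite nrm_ge0 andbT.
have /cvg_nrmP TP : (fun n => T s (\sum_(0 <= i < n) (dpow s i)%:C *: E i y))
  @ \oo --> T s P by exact: bounded_lin_cvg.
apply/ler_addgt0Pr => e e0; rewrite add0r.
have e2 : 0 < e / 2 by lra.
have c0 : 0 < M * (M * nrm y) + 1 by rewrite ltr_wpDl// !mulr_ge0// nrm_ge0.
have /cvgrPdist_lt /(_ _ (divr_gt0 e2 c0)) b1 := b0.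
have [n [/ltW]] := filter_ex (filterI (TP _ e2) b1).
rewrite sub0r normrN => Hn1 /(le_lt_trans (ler_norm _)).
rewrite ltr_pdivlMr// => Hn2.
set Sn := \sum_(_ <= _ < _) _ in Hn1; have := H n; rewrite -/Sn => Hn.
have Hx : nrm (E 0%N (T s y) - T s P) <=
   nrm (E 0%N (T s y) - T s Sn) + nrm (T s P - T s Sn).
  by rewrite (nrmBC (T s P)) (le_trans _ (nrmD _ _))// addrA subrK.
have := dpow_ge0 s n s0.
have [L0 _] := opnorm_bound _ (E_lin n) => /mulr_ge0 /(_ L0).
set z := _ * opnorm _ in Hn Hn2 *.
set c := M * _ in Hn Hn2 *; nra.
Qed.

End Exchange.

(** * From the limsup condition to geometric bounds *)

Section RootTest.
Context {R : realType}.
Implicit Types (b : nat -> R).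

(** The induction step amounts to (1 + 1/n)^n <= e, that is, to the n-th power of 1 + 1/n <=
    exp(1/n). This is where the factor e of the limsup condition comes from. *)
Lemma expn_le_fact m : m%:R ^+ m <= expR 1 ^+ m * m`!%:R :> R.
Proof.
elim: m => [|m IH]; first by rewrite !expr0 fact0 mulr1.
rewrite factS natrM !exprS mulrCA -mulrA ler_pM2l ?ltr0n//.
case: m IH => [|m] IH; first by rewrite !expr0 fact0 !mulr1 -[leLHS]expR0 ler_expR.
apply: le_trans (ler_wpM2l (expR_ge0 1) IH).
set n := m.+1; have n0 : 0 < n%:R :> R by rewrite ltr0n.
rewrite -ler_pdivrMr ?exprn_gt0// -expr_div_n -natr1 mulrDl divff ?gt_eqF// mul1r.
have -> : expR 1 = expR n%:R^-1 ^+ n :> R by rewrite -expRM_natl mulfV ?gt_eqF.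
rewrite lerXn2r// ?nnegrE ?expR_ge0 ?addr_ge0 ?invr_ge0 ?(ltW n0)//.
exact: expR_ge1Dx.
Qed.

Lemma limn_esup_lt_near (u : nat -> \bar R) (l : \bar R) : (limn_esup u < l)%E ->
  \forall n \near \oo, (u n < l)%E.
Proof.
move=> /ereal_inf_lt[_ [V Voo <-] Vl]; near=> n.
apply: le_lt_trans Vl; apply: ereal_sup_ubound; exists n => //.
near: n; exact: Voo.
Unshelve. all: by end_near. Qed.

(** Finitely many exceptional indices go into the constant: 1 serves the indices from [N] on, the
    sum of the ratios b/w the earlier ones. *)
Lemma le_scaled_bound b (w : nat -> R) N : (forall m, 0 < w m) ->
  (forall m, (N <= m)%N -> b m <= w m) -> (forall m, 0 <= b m) ->
  exists2 C, 0 <= C & forall m, b m <= C * w m.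
Proof.
move=> w0 bw b0; have bw0 m : 0 <= b m / w m by rewrite divr_ge0// ltW.
exists (1 + \sum_(0 <= i < N) b i / w i) => [|m].
  by rewrite addr_ge0// sumr_ge0.
rewrite -ler_pdivrMr//; have [Nm|mN] := leqP N m.
  apply: (@le_trans _ _ 1); first by rewrite ler_pdivrMr// mul1r bw.
  by rewrite lerDl sumr_ge0.
rewrite (@big_cat_nat _ _ _ m)//= ?(ltnW mN)// (@big_ltn _ _ _ m)//.
have S0 i j : 0 <= \sum_(i <= k < j) b k / w k by rewrite sumr_ge0.
by have := S0 0%N m; have := S0 m.+1 N; lra.
Qed.

(** Eventually b_m <= (l m)^m <= (l e)^m m!, so the factorial of [dpow] cancels and the ratio 2 chi
    l e is below 1. The bound with b_(m+1) is what makes the series of the A E_m y converge later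
    on. *)
Lemma root_test b chi : (forall m, 0 <= b m) -> 0 <= chi ->
  ((2 * expR 1 * chi)%:E *
     limn_esup (fun m => (b m `^ (m%:R^-1) / m%:R)%:E) < 1)%E ->
  exists C q : R, [/\ 0 <= C, 0 <= q < 1 & forall s, 0 <= s <= 2 * chi ->
    forall m, dpow s m * b m <= C * q ^+ m /\ dpow s m * b m.+1 <= C * q ^+ m].
Proof.
move=> b0; rewrite le_eqVlt => /predU1P[<- _|chi0 H].
  (* For chi = 0 the limsup condition reads 0 < 1 and says nothing about [b], but then s = 0 and
     only m = 0 contributes; here 0 ^+ 0 = 1. *)
  exists (b 0%N + b 1%N), 0; split; rewrite ?addr_ge0 ?lexx ?ltr01//.
  move=> s; rewrite mulr0 => /le_anti <- [|m].
    by rewrite dpowt0 expr0 !mul1r mulr1 lerDl lerDr.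
  by rewrite dpow0n expr0n !mul0r mulr0.
have e0 : 0 < expR 1 :> R by exact: expR_gt0.
have c0 : 0 < 2 * expR 1 * chi by rewrite !mulr_gt0.
move: H; rewrite -lte_pdivlMl// mule1.
set c := 2 * expR 1 * chi in c0 *; set u := fun m => _ => uc.
have [l [l0 lc ul]] : exists l : R, [/\ 0 < l, l * c < 1 &
    \forall n \near \oo, (u n < l%:E)%E].
  have [k kc uk] : exists2 k : R, k < c^-1 & (limn_esup u < k%:E)%E.
    case: (limn_esup u) uc => [x|//|_]; last first.
      by exists (c^-1 - 1); rewrite ?ltNyr// ltrBlDr ltrDl.
    rewrite lte_fin => xc; exists ((x + c^-1) / 2); rewrite ?lte_fin; lra.
  have ci : 0 < c^-1 by rewrite invr_gt0.
  (* The maximum makes [l] positive even if the number [k] above the limsup is not. *)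
  exists (Num.max k (c^-1 / 2)); split.
  - by rewrite lt_max divr_gt0 ?orbT.
  - by rewrite -ltr_pdivlMr// div1r gt_max kc /=; lra.
  - apply: filterS (limn_esup_lt_near _ _ uk) => n /lt_le_trans; apply.
    by rewrite lee_fin le_max lexx.
pose r := l * expR 1; have r0 : 0 < r by rewrite mulr_gt0.
have [N _ HN] : \forall n \near \oo, b n <= r ^+ n * n`!%:R.
  near=> n.
  have n0 : (0 < n)%N by near: n; exact: nbhs_infty_gt.
  have : (u n < l%:E)%E by near: n.
  have n0' : 0 < n%:R :> R by rewrite ltr0n.
  rewrite lte_fin ltr_pdivrMr// => /ltW h.
  have -> : b n = (b n `^ n%:R^-1) ^+ n.
    by rewrite -powR_mulrn ?powR_ge0// -powRrM mulVf ?gt_eqF// powRr1.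
  have h2 : (b n `^ n%:R^-1) ^+ n <= (l * n%:R) ^+ n.
    by rewrite lerXn2r// nnegrE ?powR_ge0// mulr_ge0// ltW.
  apply: le_trans h2 _; rewrite !exprMn -mulrA ler_pM2l ?exprn_gt0//.
  exact: expn_le_fact.
have w0 m : 0 < r ^+ m * m`!%:R by rewrite mulr_gt0 ?exprn_gt0 ?ltr0n ?fact_gt0.
have [C C0 bC] := le_scaled_bound b _ N w0 HN b0.
pose rho := 2 * chi * r.
have rho0 : 0 < rho by rewrite !mulr_gt0.
have rho1 : rho < 1 by rewrite /rho /r; move: lc; rewrite /c; lra.
(* A ratio strictly between [rho] and 1 leaves room for the factor m + 1 that b_(m+1) brings in. *)
pose q := (1 + rho) / 2.
have q0 : 0 < q - rho by rewrite /q; lra.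
have B1 m : rho ^+ m <= q ^+ m by rewrite lerXn2r// ?nnegrE ?(ltW rho0) /q; lra.
(* Bernoulli's inequality for q = rho + (q - rho): (m+1) (q - rho) rho^m is at most q^(m+1). *)
have B2 m : m.+1%:R * rho ^+ m <= q / (q - rho) * q ^+ m.
  rewrite mulrAC -exprS ler_pdivlMr// mulrAC.
  have := exprD_ge rho (q - rho) m (ltW rho0) (ltW q0).
  rewrite (addrC rho (q - rho)) subrK; apply: le_trans.
  by rewrite lerDr exprn_ge0// ltW.
have k0 : 0 <= r * (q / (q - rho)).
  by rewrite mulr_ge0 ?(ltW r0)// divr_ge0 ?(ltW q0)// /q; lra.
exists (C * (1 + r * (q / (q - rho)))), q; split.
- by rewrite mulr_ge0// addr_ge0.
- by rewrite /q; apply/andP; split; lra.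
move=> s s2 m; have q0' : 0 <= q ^+ m by rewrite exprn_ge0 /q; lra.
have dm x : 0 <= x -> dpow s m * (C * (r ^+ m * m`!%:R * x)) <= C * (rho ^+ m * x).
  move=> x0; apply: le_trans (ler_wpM2r _ (dpow_le _ _ m s2)) _.
    by rewrite !mulr_ge0// ?ltW// exprn_gt0.
  rewrite le_eqVlt; apply/orP; left; apply/eqP.
  rewrite /dpow /rho [in RHS]exprMn; set p := (2 * chi) ^+ m.
  by field; exact: fact_neq0.
split.
  apply: le_trans (ler_wpM2l (dpow_ge0 _ _ _) (bC m)) _; first by case/andP: s2.
  have := dm 1 ler01; rewrite !mulr1 => /le_trans; apply.
  rewrite -mulrA ler_wpM2l// mulrDl mul1r (le_trans (B1 m))// lerDl.
  by rewrite mulr_ge0.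
apply: le_trans (ler_wpM2l (dpow_ge0 _ _ _) (bC m.+1)) _; first by case/andP: s2.
(* r (m+1) is the quotient of the weights r^m m! at m+1 and at m. *)
have := dm (r * m.+1%:R); rewrite mulr_ge0 ?(ltW r0)// => /(_ isT).
rewrite factS natrM exprSr (_ : r ^+ m * r * _ = r ^+ m * m`!%:R * (r * m.+1%:R)).
  move=> /le_trans; apply; rewrite -[leRHS]mulrA ler_wpM2l//.
  rewrite mulrDl mul1r mulrCA (mulrC (rho ^+ m)) -[leLHS]add0r lerD//.
  by rewrite -[leRHS]mulrA ler_wpM2l ?(ltW r0).
by ring.
Unshelve. all: by end_near. Qed.

End RootTest.

(** * The series P_s y stays in the domain of the generator *)

Section SeriesDomain.
Context {R : realType} {X : completeNormedModType R[i]}.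
Context {A : op X} {E : nat -> X -> X} {s C q : R}.
Hypothesis A_closed : closed_op A.
Hypothesis E_lin : forall m, bounded_lin (E m).
Hypothesis E_dom : forall m y, dom A y -> dom A (E m y).
Hypothesis E_comm : forall m y, dom A y ->
  E m.+1 y = E m (app A y) - app A (E m y).
Hypotheses (s0 : 0 <= s) (C0 : 0 <= C) (q01 : 0 <= q < 1).
Hypothesis E_bound : forall m, dpow s m * opnorm (E m) <= C * q ^+ m.
Hypothesis E_boundS : forall m, dpow s m * opnorm (E m.+1) <= C * q ^+ m.

Lemma op_sum (c : nat -> R[i]) (u : nat -> X) n : (forall i, dom A (u i)) ->
  dom A (\sum_(0 <= i < n) c i *: u i) /\
  app A (\sum_(0 <= i < n) c i *: u i) = \sum_(0 <= i < n) c i *: app A (u i).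
Proof.
case: A_closed => -[A0 [AD AZ]] _ Au; elim: n => [|n [IH1 IH2]].
  rewrite !big_geq//; split=> //.
  by have [_] := AZ 0 0 A0; rewrite !scale0r.
rewrite !big_nat_recr//=; have [Acu Acu'] := AZ (c n) _ (Au n).
by have [h1 h2] := AD _ _ IH1 Acu; split=> //; rewrite h2 IH2 Acu'.
Qed.

Lemma term_bound (F : X -> X) y m : bounded_lin F -> dpow s m * opnorm F <= C * q ^+ m ->
  nrm ((dpow s m)%:C *: F y) <= C * nrm y * q ^+ m.
Proof.
move=> bF Fq; have [_ Fy] := opnorm_bound F bF; have ds := dpow_ge0 s m s0.
rewrite nrmZ ger0_norm//; apply: le_trans (ler_wpM2l ds (Fy y)) _.
by rewrite mulrA [leRHS]mulrAC ler_wpM2r ?nrm_ge0.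
Qed.

(** The partial sums lie in D(A), and so does their limit once their images under A converge as
    well, the graph being closed. Those images converge because A E_m y = E_m A y - E_(m+1) y, with
    both parts geometrically bounded. *)
Lemma exchange_series y : dom A y ->
  exists P, [/\ (fun n => \sum_(0 <= i < n) (dpow s i)%:C *: E i y) @ \oo --> P,
    dom A P & nrm P <= C / (1 - q) * nrm y].
Proof.
move=> Ay.
have [P SP Pb] := series_geometric_bound _ _ q (mulr_ge0 C0 (nrm_ge0 y)) q01
  (fun m => term_bound _ y m (E_lin m) (E_bound m)).
exists P; split=> //; last by rewrite mulrAC.
have [Q SQ _] : exists2 Q, (fun n => \sum_(0 <= i < n)
    (dpow s i)%:C *: app A (E i y)) @ \oo --> Q &
    nrm Q <= (C * nrm (app A y) + C * nrm y) / (1 - q).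
  apply: series_geometric_bound => // [|m].
    by rewrite addr_ge0// mulr_ge0// nrm_ge0.
  have -> : app A (E m y) = E m (app A y) - E m.+1 y.
    by rewrite E_comm// opprB addrC subrK.
  rewrite scalerBr mulrDl; apply: le_trans (nrmB _ _) _.
  by rewrite lerD// term_bound.
case: (A_closed) => _ cA.
have : graph A (P, Q).
  apply: (@closed_cvg _ _ \oo _ (fun n =>
    (\sum_(0 <= i < n) (dpow s i)%:C *: E i y,
     \sum_(0 <= i < n) (dpow s i)%:C *: app A (E i y))) (graph A) cA); last first.
    exact: (cvg_pair SP SQ).
  apply: nearW => n /=.
  by have [h1 h2] := op_sum (fun i => (dpow s i)%:C) (E^~ y) n (fun i => E_dom i y Ay).
by case.
Qed.

Lemma cvg_dpow_opnorm : (fun n => dpow s n * opnorm (E n)) @ \oo --> (0 : R).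
Proof.
have q0 : (fun n => C * q ^+ n) @ \oo --> (0 : R).
  by apply: cvg_geometric; case/andP: q01 => h1 h2; rewrite ger0_norm.
apply: squeeze_cvgr (cvg_cst 0) q0; apply: nearW => n.
by rewrite E_bound mulr_ge0 ?dpow_ge0//; case: (opnorm_bound _ (E_lin n)).
Qed.

End SeriesDomain.

(** * Solutions of impulsive systems and transfer of stability *)

Section Impulsive.
Context {R : realType} {X : completeNormedModType R[i]}.
Context {A : op X} {T : R -> X -> X}.
Hypothesis AT : generates A T.
Implicit Types (s tau : nat -> R) (J : nat -> X -> X).

Lemma interval_index s t N : s 0%N < t -> t <= s N ->
  exists k, s k < t <= s k.+1.
Proof.
move=> s0t tN; have ex : exists n, t <= s n by exists N.
case: (ex_minnP ex) => -[|k] tk kmin; first by move: s0t; rewrite ltNge tk.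
exists k; rewrite tk andbT ltNge; apply/negP => /kmin.
by rewrite ltnn.
Qed.

Lemma interval_index_uniq s t j k : (forall n, s n < s n.+1) ->
  s j < t <= s j.+1 -> s k < t <= s k.+1 -> j = k.
Proof.
move=> s_incr.
have s_le := homo_leq (@lexx _ R) (@le_trans _ R) (fun n => ltW (s_incr n)).
wlog jk : j k / (j <= k)%N.
  by move=> H; have [/H|/ltnW kj sj sk] := leqP j k; [exact|rewrite (H k j)].
move=> /andP[_ tj] /andP[kt _]; apply/eqP; rewrite eqn_leq jk /= leqNgt.
by apply/negP => /s_le; rewrite leNgt (lt_le_trans kt tj).
Qed.

(** Stability is a statement about all solutions; drawing a bound from it for a given initial value
    requires a solution to exist. *)
Lemma exists_solution s J x0 : (forall n, s n < s n.+1) ->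
  exists x, is_solution T s J x0 x.
Proof.
move=> s_incr.
exists (fun t => let k := xget 0%N [set k | s k < t <= s k.+1] in
  T (t - s k) (post_state T s J x0 k)) => k t kt /=.
have kP : [set k | s k < t <= s k.+1] k by [].
have /= jt := xgetI 0%N kP.
by rewrite (interval_index_uniq s t _ _ s_incr jt kt).
Qed.

(** The state just after a jump is only a right limit of the solution. Right continuity at 0 carries
    bounds on the following interval back to it. *)
Lemma orbit_start_bound x (c r : R) : 0 < r ->
  (forall h, 0 < h <= r -> nrm (T h x) <= c) -> nrm x <= c.
Proof.
move=> r0 H; apply/ler_addgt0Pr => e e0.
have : \forall h \near (0 : R)^'+, nrm x <= c + e.
  near=> h.
  have h0 : 0 < h by near: h; exact: nbhs_right_gt.
  have hr : h <= r by near: h; exact: nbhs_right_le.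
  have H1 : nrm (T h x - x) <= e by near: h; exact: (sg_right_continuous AT).
  have H2 : nrm (T h x) <= c by apply: H; rewrite h0.
  rewrite nrmBC in H1; rewrite -(subrK (T h x) x).
  by rewrite (le_trans (nrmD _ _))// addrC lerD.
by move=> /filter_ex[].
Unshelve. all: by end_near. Qed.

(* Only D(A) is controlled by the hypothesis; density extends the bound to X. *)
Lemma sg_bound_of_small_orbits (theta d : R) : densely_defined A -> closed_op A ->
  0 < d -> (forall x, dom A x -> nrm x < d ->
     forall t, 0 < t <= theta -> nrm (T t x) <= 1) ->
  exists2 M : R, 0 <= M & forall t x, 0 <= t <= theta -> nrm (T t x) <= M * nrm x.
Proof.
move=> Ad [[_ [_ AZ]] _] d0 H.
have M0 : 0 <= 1 + 2 / d by rewrite addr_ge0// divr_ge0// ltW.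
(* 2/d comes from scaling to norm d/2; the summand 1 covers t = 0, where T_0 is the identity. *)
exists (1 + 2 / d) => // t x /andP[t0 tt].
have bT := sg_lin AT t t0.
have Hd y : dom A y -> nrm (T t y) <= (1 + 2 / d) * nrm y.
  move=> Ay; have [->|t_neq0] := eqVneq t 0.
    by rewrite (sg0 AT) mulrDl mul1r lerDl mulr_ge0 ?nrm_ge0// divr_ge0// ltW.
  have [y0|y0] := eqVneq (nrm y) 0.
    by rewrite (nrm_eq0 _ y0) bounded_lin0// nrm0 mulr0.
  have {}y0 : 0 < nrm y by rewrite lt_def y0 nrm_ge0.
  set c := d / (2 * nrm y); have c0 : 0 < c by rewrite divr_gt0// mulr_gt0.
  have := H (c%:C *: y) (AZ _ _ Ay).1; rewrite nrmZ (gtr0_norm c0).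
  have -> : c * nrm y = d / 2 by rewrite /c; field; rewrite gt_eqF.
  have t0' : 0 < t <= theta by rewrite lt_def t_neq0 t0.
  have d2 : d / 2 < d by lra.
  move=> /(_ d2 t t0').
  rewrite bounded_linZ// nrmZ (gtr0_norm c0) -ler_pdivlMl// mulr1.
  move=> /le_trans; apply; rewrite mulrDl mul1r.
  have -> : c^-1 = 2 / d * nrm y by rewrite /c; field; rewrite !gt_eqF.
  by rewrite lerDr nrm_ge0.
(* [L] depends on [t], but it only multiplies the approximation error x - y, so it does not enter
   the final constant. *)
have [L L0 TL] := bounded_lin_bound _ bT.
apply/ler_addgt0Pr => e e0.
have c0 : 0 < L + (1 + 2 / d) by rewrite ltr_wpDl// ltr_pwDl// divr_ge0// ltW.
have : closure (dom A) x by rewrite Ad.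
have ec : 0 < (e / (L + (1 + 2 / d)))%:C :> R[i] by rewrite ltcR divr_gt0.
move=> /(_ _ (nbhsx_ballx x _ ec)) [y [Ay]].
rewrite -ball_normE /= -nrmE ltcR ltr_pdivlMr// => xy.
have H1 : nrm (T t x) <= nrm (T t (x - y)) + nrm (T t y).
  by rewrite bounded_linB// -{1}(subrK (T t y) (T t x)) nrmD.
have H2 : nrm y <= nrm (x - y) + nrm x.
  by rewrite (nrmBC x) -{1}(subrK x y) nrmD.
have H3 := ler_wpM2l M0 H2; have H4 := Hd y Ay; have H5 := TL (x - y); lra.
Qed.

Lemma sg_bound_double (c M : R) : 0 <= M ->
  (forall t x, 0 <= t <= c -> nrm (T t x) <= M * nrm x) ->
  forall t x, 0 <= t <= 2 * c -> nrm (T t x) <= M ^+ 2 * nrm x.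
Proof.
move=> M0 H t x /andP[t0 tc].
have t2 : 0 <= t / 2 <= c by lra.
have t20 : 0 <= t / 2 by lra.
rewrite (_ : t = t / 2 + t / 2); last by rewrite -splitr.
rewrite (sgD AT)// (le_trans (H _ _ t2))// expr2 -mulrA ler_wpM2l//.
exact: H.
Qed.

Lemma nrm_cvg_pinfty0 (x : R -> X) : x t @[t --> +oo] --> 0 <->
  forall e : R, 0 < e -> exists S, forall t, S < t -> nrm (x t) < e.
Proof.
split=> [/cvg_nrmP H e /H[S [_ HS]]|H].
  by exists S => t /HS; rewrite sub0r nrmN.
apply/cvg_nrmP => e /H[S HS]; exists S; split; first exact: num_real.
by move=> t /HS; rewrite sub0r nrmN.
Qed.

(** After its first interval, each solution on [tau] is dominated by the post-jump states of a
    reference solution on [s], one jump behind. Bounds on the reference solution pass to its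
    post-jump states by [orbit_start_bound], and from there to [tau]. *)
Lemma asymp_stable_compare (D : set X) s tau J J' (theta L M : R) :
  0 < theta -> (forall k, s k.+1 = s k + theta) -> s n @[n --> \oo] --> +oo ->
  (forall k, tau k < tau k.+1) -> tau n @[n --> \oo] --> +oo ->
  0 <= L -> 0 <= M ->
  (forall x, D x -> forall t, 0 < t <= tau 1%N - tau 0%N ->
     nrm (T t x) <= M * nrm x) ->
  (forall x, D x -> exists z, [/\ D z, nrm z <= L * nrm x &
     forall k t, 0 < t <= tau k.+2 - tau k.+1 ->
       nrm (T t (post_state T tau J' x k.+1)) <= M * nrm (post_state T s J z k)]) ->
  asymp_stable D T s J -> asymp_stable D T tau J'.
Proof.
move=> theta0 sS s_oo tau_incr tau_oo L0 M0 first later [stab attr].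
have s_incr k : s k < s k.+1 by rewrite sS ltrDl.
have tau_le := homo_leq (@lexx _ R) (@le_trans _ R) (fun n => ltW (tau_incr n)).
have tau_index t : tau 0%N < t -> exists k, tau k < t <= tau k.+1.
  move=> t0; have /cvgryPge /(_ t) [N _ /(_ N (leqnn N)) tN] := tau_oo.
  exact: interval_index t0 tN.
have post_le z y c k : is_solution T s J z y ->
    (forall t, s k < t -> nrm (y t) <= c) -> nrm (post_state T s J z k) <= c.
  move=> sy yc; apply: (orbit_start_bound _ _ _ theta0) => h /andP[h0 hr].
  have kh : s k < s k + h <= s k.+1 by rewrite ltrDl h0 sS lerD2l.
  by have := yc _ (andP kh).1; rewrite (sy k _ kh) addrAC subrr add0r.
split=> [eps eps0|x0 x Dx0 sx].
  have M1 : 0 < M + 1 by rewrite ltr_wpDl.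
  have L1 : 0 < L + 1 by rewrite ltr_wpDl.
  set e := eps / (M + 1); have e0 : 0 < e by rewrite divr_gt0.
  have Me c : c <= e -> 0 <= c -> M * c < eps.
    rewrite /e ler_pdivlMr// => ce c0; move: c0; rewrite le_eqVlt => /predU1P[<-|c0].
      by rewrite mulr0.
    by apply: lt_le_trans ce; rewrite mulrC ltr_pM2l// ltrDl.
  have [d d0 Hd] := stab e e0.
  (* [e] handles the interval before the first jump; d/(L+1) makes the reference solution start
     within [d]. *)
  exists (Num.min e (d / (L + 1))); first by rewrite lt_min e0 divr_gt0.
  move=> x0 x Dx0; rewrite -nrmE ltcR lt_min => /andP[x0e].
  rewrite ltr_pdivlMr// => x0d sx t /tau_index[[|k] kt].
    rewrite -nrmE ltcR (sx _ _ kt) /=; apply: le_lt_trans (first _ Dx0 _ _) _.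
      by case/andP: kt => k1 k2; rewrite subr_gt0 k1 lerD2r.
    by rewrite Me ?nrm_ge0// ltW.
  have [z [Dz zx zk]] := later _ Dx0.
  have [y sy] := exists_solution s J z s_incr.
  rewrite -nrmE ltcR (sx _ _ kt); apply: le_lt_trans (zk _ _ _) _.
    by case/andP: kt => k1 k2; rewrite subr_gt0 k1 lerD2r.
  rewrite Me ?nrm_ge0//; apply: (post_le z y) => // u ku; apply: ltW.
  have := Hd z y Dz; rewrite -!nrmE !ltcR => /(_ _ sy u).
  rewrite -nrmE ltcR; apply.
    apply: le_lt_trans zx _; apply: le_lt_trans x0d.
    by rewrite mulrC ler_wpM2l ?nrm_ge0// lerDl.
  apply: le_lt_trans ku.
  exact: (homo_leq (@lexx _ R) (@le_trans _ R) (fun n => ltW (s_incr n))).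
apply/nrm_cvg_pinfty0 => eps eps0.
have [z [Dz zx zk]] := later _ Dx0.
have [y sy] := exists_solution s J z s_incr.
have M1 : 0 < M + 1 by rewrite ltr_wpDl.
have /nrm_cvg_pinfty0 /(_ _ (divr_gt0 eps0 M1)) [S HS] := attr z y Dz sy.
have /cvgryPge /(_ S) [N _ HN] := s_oo.
(* Past this time at least N + 1 jumps have occurred, so the reference index, one less, is at least
   [N]. *)
exists (tau N.+1) => t Nt.
have [k kt] := tau_index t (le_lt_trans (tau_le _ _ (leq0n _)) Nt).
have Nk : (N < k)%N.
  rewrite ltnNge; apply/negP => kN; case/andP: kt => _.
  by rewrite leNgt => /negP; apply; apply: le_lt_trans Nt; exact: tau_le.
case: k Nk kt => // k; rewrite ltnS => Nk kt.
rewrite (sx _ _ kt); apply: le_lt_trans (zk _ _ _) _.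
  by case/andP: kt => k1 k2; rewrite subr_gt0 k1 lerD2r.
have : nrm (post_state T s J z k) <= eps / (M + 1).
  apply: (post_le z y) => // u ku; apply/ltW/HS/(le_lt_trans _ ku).
  exact: HN.
have := nrm_ge0 (post_state T s J z k); rewrite ler_pdivlMr//.
set c := nrm _; move=> c0 cM.
move: c0; rewrite le_eqVlt => /predU1P[<-|c0]; first by rewrite mulr0.
by apply: lt_le_trans cM; rewrite mulrC ltr_pM2l// ltrDl.
Qed.

End Impulsive.

(** * The commutator recursion and the comparison of (S) with (C) *)

Lemma nested_commutatorS {R : realType} {X : completeNormedModType R[i]}
    (A B : op X) (Cm : nat -> op X) m x :
  nested_commutators A B Cm -> dom A x ->
  app (Cm m.+1) x = app (Cm m) (app A x) - app A (app (Cm m) x).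
Proof.
move=> [_ /(_ m)[_ [hatDA cl]]] Ax.
(* D(A) already lies in the domain of the operator whose closure is taken, and the closure extends
   that operator. *)
have : graph (Cm m.+1) (x, app (Cm m) (app A x) - app A (app (Cm m) x)).
  by rewrite -cl; apply: subset_closure; split=> //; exact: hatDA.
by case.
Qed.

Theorem theorem1 (R : realType) (X : completeNormedModType R[i])
  (A B : op X) (Cm : nat -> op X) (T : R -> X -> X)
  (a phi K eta K1 : R) (tau : nat -> R) (theta chimax : R) :
  sectorial A a phi K ->
  generates A T ->
  closed_op B ->
  dom A `<=` dom B ->
  (forall x, dom A x -> dom A (app B x)) ->
  nested_commutators A B Cm ->
  (forall (m : nat) x, dom A x -> dom A (app (Cm m) x)) ->
  0 < eta -> 0 < K1 ->
  (forall (m : nat) (l : R[i]), sector a phi l ->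
     forall Rs, is_resolvent A l Rs ->
     forall y, dom (Cm m) (Rs y) /\
       `|app (Cm m) (Rs y)| <= (K1 * eta ^+ m)%:C / `|l - a%:C| * `|y|) ->
  (forall k : nat, tau k < tau k.+1) ->
  tau n @[n --> \oo] --> +oo ->
  0 < theta -> 0 <= chimax < theta ->
  (forall k : nat, `|tau k - tau 0%N - k%:R * theta| <= chimax) ->
  (forall m : nat, (forall x, dom (Cm m) (T (theta - chimax) x)) /\
     bounded_lin (fun x => app (Cm m) (T (theta - chimax) x))) ->
  ((2 * expR 1 * chimax)%:E *
     limn_esup (fun m : nat =>
       ((opnorm (fun x => app (Cm m) (T (theta - chimax) x))) `^ (m%:R^-1)
          / m%:R)%:E) < 1)%E ->
  let chi := fun k : nat => tau k - tau 0%N - k%:R * theta in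
  asymp_stable (dom A) T (fun k : nat => k%:R * theta)
    (fun (k : nat) (w : X) => app B w +
       limn (fun n : nat => \sum_(1 <= m < n)
                ((((chimax + chi k.+2) ^+ m / (m`!)%:R)%:C) *: app (Cm m) w))) ->
  asymp_stable (dom A) T tau (fun _ => app B).
Proof.
move=> [A_cl [A_dense _]] AT _ _ _ comm Cm_dom _ _ _ tau_incr tau_oo theta0
  /andP[chi0 chi_lt] chi_le E_prop limsup chi.
(* [J k] acts at time (k+1) theta, hence [chi k.+2] where (C) has chi_(k+1) at time k theta. *)
set J := (Y in asymp_stable _ _ _ Y); move=> C_stable.
pose E m y := app (Cm m) (T (theta - chimax) y).
have r0 : 0 <= theta - chimax by rewrite subr_ge0 ltW.
have E_lin m : bounded_lin (E m) := (E_prop m).2.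
have E_dom m y : dom A y -> dom A (E m y).
  by move=> Ay; apply: Cm_dom; exact: (sg_dom AT _ _ r0 Ay).1.
have E_comm m y : dom A y -> E m.+1 y = E m (app A y) - app A (E m y).
  move=> Ay; have [ATy AT'] := sg_dom AT _ _ r0 Ay.
  by rewrite /E (nested_commutatorS _ _ _ _ _ comm)// AT'.
have [C [q [C0 q01 E_bound]]] := root_test _ chimax
  (fun m => (opnorm_bound _ (E_lin m)).1) chi0 limsup.
(* The deviations shifted to be nonnegative: the semigroup runs forward only, and [root_test] covers
   [0, 2 chimax]. *)
pose sg k := chimax + chi k.
have sg_bound k : 0 <= sg k <= 2 * chimax.
  by have := chi_le k; rewrite -/(chi k) /sg ler_norml; lra.
have chi00 : chi 0%N = 0 by rewrite /chi subrr mul0r subrr.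
have tauS k : tau k.+1 - tau k = theta + sg k.+1 - sg k.
  by rewrite /sg /chi -natr1; ring.
have s_incr k : k%:R * theta < k.+1%:R * theta by rewrite ltr_pM2r// ltr_nat.
(* On (0, theta] a solution of (C) is just T_t x, so stability with tolerance 1 bounds T there;
   doubling twice gives 4 theta. The times needed below are at most theta + 2 chimax, hence less
   than 3 theta. *)
have [M M0 TM] : exists2 M : R, 0 <= M &
    forall t x, 0 <= t <= 4 * theta -> nrm (T t x) <= M * nrm x.
  case: (C_stable) => /(_ 1 ltr01)[d d0 Hd] _.
  have small x : dom A x -> nrm x < d ->
      forall t, 0 < t <= theta -> nrm (T t x) <= 1.
    move=> Ax xd t tt.
    have [y sy] := @exists_solution _ _ T (fun k => k%:R * theta) J x s_incr.
    have := Hd x y Ax; rewrite -nrmE ltcR => /(_ xd sy t).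
    rewrite mul0r (sy 0%N t) /= ?mul0r ?mul1r// subr0 -nrmE ltcR.
    by case/andP: tt => t0 _ /(_ t0) /ltW.
  have [M M0 TM] := sg_bound_of_small_orbits AT theta d A_dense A_cl d0 small.
  exists (M ^+ 2 ^+ 2) => [|t x]; first by rewrite !exprn_ge0.
  rewrite (_ : 4 * theta = 2 * (2 * theta)); last by ring.
  apply: (sg_bound_double AT); first by rewrite exprn_ge0.
  exact: (sg_bound_double AT).
pose P s y := limn (fun n => \sum_(0 <= i < n) (dpow s i)%:C *: E i y).
have PE k y : dom A y -> [/\
    (fun n => \sum_(0 <= i < n) (dpow (sg k) i)%:C *: E i y) @ \oo --> P (sg k) y,
    dom A (P (sg k) y), nrm (P (sg k) y) <= C / (1 - q) * nrm y &
    E 0%N (T (sg k) y) = T (sg k) (P (sg k) y)].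
  move=> Ay; have Eb := E_bound _ (sg_bound k).
  have /andP[s0 s2] := sg_bound k.
  have [Q [SQ AQ Qb]] := exchange_series A_cl E_lin E_dom E_comm s0 C0 q01
    (fun m => (Eb m).1) (fun m => (Eb m).2) y Ay.
  have -> : P (sg k) y = Q by apply: cvg_lim SQ; exact: norm_hausdorff.
  split=> //; apply: (@semigroup_exchange _ _ _ _ _ M _ AT) => //.
  - move=> t x /andP[t0 ts]; apply: TM; rewrite t0 /=; lra.
  - exact: (cvg_dpow_opnorm E_lin s0 q01 (fun m => (Eb m).1)).
(* B supplies the term m = 0 missing from the sum in (C), so on states T_(theta-chimax) y the jump
   is the whole series P. *)
have JE k y : dom A y -> J k (T (theta - chimax) y) = P (sg k.+2) y.
  move=> Ay; have [SP _ _ _] := PE k.+2 y Ay.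
  have -> : J k (T (theta - chimax) y) = E 0%N y + (P (sg k.+2) y - E 0%N y).
    rewrite /J; congr (_ + _); first by rewrite /E (comm.1).
    apply: cvg_lim; first exact: norm_hausdorff.
    apply: cvg_trans (cvgB SP (cvg_cst (E 0%N y))).
    apply: near_eq_cvg; near=> n.
    have n0 : (0 < n)%N by near: n; exact: nbhs_infty_gt.
    rewrite -[LHS]/(\sum_(0 <= i < n) (dpow (sg k.+2) i)%:C *: E i y - E 0%N y).
    by rewrite (@big_ltn _ _ _ 0 n)// dpowt0 scale1r addrAC subrr add0r.
  by rewrite addrC subrK.
apply: (asymp_stable_compare AT _ _ _ J _ theta (C / (1 - q)) M) C_stable => //.
- by move=> k; rewrite -natr1 mulrDl mul1r.
- apply/cvgryPge => c; near=> n; rewrite -ler_pdivrMr//.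
  by near: n; exact: nbhs_infty_ger.
- by case/andP: q01 => ? ?; rewrite divr_ge0// subr_ge0 ltW.
- move=> x Ax t /andP[t0]; rewrite tauS {2}/sg chi00 => t1.
  by apply: TM; rewrite ltW//=; have := sg_bound 1%N; lra.
move=> x Ax; exists (P (sg 1%N) x); have [_ AP Pb EP] := PE 1%N x Ax.
split=> // k t /andP[t0 tk].
set z := post_state T _ J (P (sg 1%N) x).
(* The invariant x_(n+1) = T_(s_(n+1)) z_n. To start it, tau_1 - tau_0 = (theta - chimax) + s_1
   because chi_0 = 0, and B T_(theta-chimax) is E_0. *)
have zE n : dom A (z n) /\ post_state T tau (fun=> app B) x n.+1 = T (sg n.+1) (z n).
  have E0 y : app B (T (theta - chimax) y) = E 0%N y by rewrite /E (comm.1).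
  elim: n => [|n [An IH]].
    split=> //; rewrite /= tauS {2}/sg chi00 addr0.
    rewrite (_ : _ - _ = theta - chimax + sg 1%N); last by ring.
    by rewrite (sgD AT) ?E0//; case/andP: (sg_bound 1%N).
  have /andP[s1 _] := sg_bound n.+1; have /andP[s2 _] := sg_bound n.+2.
  have [AchiT _] := sg_dom AT chimax (z n) chi0 An.
  have [_ AP' _ EP'] := PE n.+2 _ AchiT.
  (* The period theta of (C) is split as (theta - chimax) + chimax. In (S) the total time from z_n
     to the jump is theta + s_(n+2) = (theta - chimax) + s_(n+2) + chimax, so the exchange formula
     applies at T_chimax z_n. *)
  have zS : z n.+1 = P (sg n.+2) (T chimax (z n)).
    rewrite -JE// -(sgD AT)// subrK /z /= -natr1 mulrDl mul1r.
    by rewrite addrAC subrr add0r.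
  rewrite zS; split=> //.
  rewrite -EP' -E0 -(sgD AT _ _ _ s2 chi0) -(sgD AT _ _ _ r0 (addr_ge0 s2 chi0)).
  set w := (Y in _ = Y); rewrite -[LHS]/(app B (T (tau n.+2 - tau n.+1)
    (post_state T tau (fun=> app B) x n.+1))) IH -(sgD AT)//; last first.
    by rewrite subr_ge0 ltW.
  by rewrite tauS /w; congr (app B (T _ _)); ring.
(* T_t x_(k+1) = T_(t + s_(k+1)) z_k, where the total time is at most theta + s_(k+2). *)
rewrite (zE k).2; have /andP[s0 s2] := sg_bound k.+1.
rewrite -(sgD AT _ _ _ (ltW t0) s0); apply: TM; move: tk; rewrite tauS.
by have := sg_bound k.+2; lra.
Unshelve. all: by end_near. Qed.
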